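(* Let $(\Omega,\mathscr{F},P)$ be a finite probability space, $N$ a fixed positive integer, and $A_1,\dots,A_N$ events. If $\boldsymbol{c}=(c_1,\dots,c_N)^T\in\mathbb{R}^N$ satisfies $\sum_{k\in B}c_k\neq 0$ for all $B\in\mathscr{B}$, then $$P\left(\bigcup_{i=1}^N A_i\right)=\sum_{i=1}^N\ \sum_{B\in\mathscr{B}:\, i\in B}\frac{c_i\,p_B}{\sum_{k\in B}c_k}=\sum_{i=1}^N\sum_{\omega\in A_i}\frac{c_i\,p(\omega)}{\sum_{\{k:\,\omega\in A_k\}}c_k}.$$
   Context: $\mathscr{B}$ denotes the collection of all non-empty subsets of $\{1,\dots,N\}$. For $B\in\mathscr{B}$, $\omega_B$ denotes the atom of $\bigcup_{i=1}^N A_i$ contained in $A_i$ exactly for those $i\in B$, i.e. $\omega_B=\bigcap_{i\in B}A_i\setminus\bigcup_{i\notin B}A_i$ (possibly empty), and $p_B:=P(\omega_B)$. There are $2^N-1$ such atoms. For $\omega\in\Omega$, $p(\omega):=P(\{\omega\})$; the probability space is finite, with every singleton measurable. *)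

(* Defs.v *)
From HB Require Import structures.
From mathcomp Require Import all_boot all_order all_algebra.
From mathcomp Require Import all_classical all_reals all_analysis.

Set Implicit Arguments.
Unset Strict Implicit.
Unset Printing Implicit Defensive.

Import Order.TTheory GRing.Theory Num.Theory.

Local Open Scope classical_set_scope.
Local Open Scope ring_scope.

(* The events A_1, ..., A_N are indexed from 0, by 'I_N. *)

Definition scrB (N : nat) : {set {set 'I_N}} := [set B | B != finset.set0]%SET.

Definition atom (T : Type) (N : nat) (A : 'I_N -> set T) (B : {set 'I_N}) :
  set T :=
  (\bigcap_(i in [set` B]) A i) `\` (\bigcup_(i in ~` [set` B]) A i).

(* The library's measures take values in \bar R; a probability is always
   finite, so fine loses nothing. *)
Definition pr d (T : measurableType d) (R : realType) (P : probability T R)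
  (E : set T) : R := fine (P E).

(* Main.v *)
Require Import Defs.
From HB Require Import structures.
From mathcomp Require Import all_boot all_order all_algebra.
From mathcomp Require Import all_classical all_reals all_analysis.

Import Order.TTheory GRing.Theory Num.Theory.

Local Open Scope classical_set_scope.
Local Open Scope ring_scope.

(* Let S(w) be the set of indices k with w in A_k. Each point w of the union
   carries mass p(w) = sum_(i in S(w)) c_i p(w) / sum_(k in S(w)) c_k, and
   exchanging the two sums gives the sum over points. The atom of B is
   {w | S(w) = B}, so grouping the points of A_i by the value of S gives the
   sum over atoms. *)

Definition occ {T : Type} {N : nat} (A : 'I_N -> set T) (w : T) : {set 'I_N} :=
  [set k | w \in A k]%SET.

Lemma mem_atom {T : Type} {N : nat} (A : 'I_N -> set T) (B : {set 'I_N}) w :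
  (w \in atom A B) = (occ A w == B).
Proof.
apply/idP/eqP => [|<-].
  rewrite inE => -[inB outB]; apply/setP => k; rewrite !inE.
  apply/idP/idP => [|kB]; last by rewrite inE; exact: inB.
  rewrite inE => Akw; apply: contra_notT outB => kNB.
  by exists k => //=; apply/negP.
rewrite inE; split=> [k /=|[k /= kNB Akw]]; first by rewrite !inE.
by apply: kNB; rewrite !inE.
Qed.

(** Every sum over a subset becomes a filtered sum over one fixed list of all points, so that sums
    over different sets can be partitioned and exchanged. *)
Lemma fsum_setT {V : nmodType} {T : choiceType} (E : set T) (f : T -> V) :
  finite_set [set: T] ->
  \sum_(w \in E) f w = \sum_(w <- finmap.enum_fset (fset_set [set: T]) | w \in E) f w.
Proof.
by move=> finT; rewrite fsbig_mkcond fsbig_finite// [RHS]big_mkcond.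
Qed.

(** Finite additivity, applied to [E] as the disjoint union of its singletons. *)
Lemma pr_fsum {R : realType} {d : measure_display} {T : measurableType d}
    (P : probability T R) (E : set T) :
  finite_set [set: T] -> (forall w : T, measurable [set w]) ->
  pr P E = \sum_(w \in E) pr P [set w].
Proof.
move=> T_finite T_singletons.
have finE : finite_set E by exact: sub_finite_set T_finite.
rewrite /pr -{1}(image_id E) -bigcup_imset1 measure_fin_bigcup//; last first.
  by move=> i j _ _ [x [/= <- <-]].
by rewrite !fsbig_finite// sum_fine// => w _; exact: fin_num_measure.
Qed.

Theorem lemma2p1 (R : realType) (d : measure_display) (T : measurableType d)
    (P : probability T R)
    (T_finite : finite_set [set: T])
    (T_singletons : forall w : T, measurable [set w])
    (N : nat) (N_gt0 : (0 < N)%N)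
    (A : 'I_N -> set T) (A_events : forall i, measurable (A i))
    (c : 'cV[R]_N)
    (c_sums : forall B, B \in scrB N -> \sum_(k in B) c k ord0 != 0) :
  pr P (\bigcup_(i in [set: 'I_N]) A i)
    = \sum_(i < N) \sum_(B in scrB N | i \in B)
        c i ord0 * pr P (atom A B) / (\sum_(k in B) c k ord0)
  /\
  \sum_(i < N) \sum_(B in scrB N | i \in B)
      c i ord0 * pr P (atom A B) / (\sum_(k in B) c k ord0)
    = \sum_(i < N) \sum_(w \in A i)
        c i ord0 * pr P [set w] / (\sum_(k < N | w \in A k) c k ord0).
Proof.
have prE E : pr P E = \sum_(w <- finmap.enum_fset (fset_set [set: T]) | w \in E) pr P [set w].
  by rewrite pr_fsum// fsum_setT.
have occE w : \sum_(k < N | w \in A k) c k ord0 = \sum_(k in occ A w) c k ord0.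
  by apply: eq_bigl => k; rewrite inE.
have atoms_points :
    \sum_(i < N) \sum_(B in scrB N | i \in B)
        c i ord0 * pr P (atom A B) / (\sum_(k in B) c k ord0)
    = \sum_(i < N) \sum_(w \in A i)
        c i ord0 * pr P [set w] / (\sum_(k < N | w \in A k) c k ord0).
  apply: eq_bigr => i _; rewrite fsum_setT//.
  (* The points of [A i] are grouped by the value of [occ A]. *)
  rewrite (partition_big (occ A) (fun B => (B \in scrB N) && (i \in B))) /=.
    apply: eq_bigr => B /andP[_ iB].
    rewrite prE mulr_sumr mulr_suml.
    (* Since [i \in B], all of [atom A B] lies in [A i], so the group of [B] is the whole atom; on
       it both denominators agree. *)
    apply: eq_big => [w|w]; rewrite mem_atom; last by move/eqP=> <-; rewrite occE.
    by case: eqP => [occB|]; rewrite ?andbF// andbT -occB inE in iB *.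
  move=> w Aiw; have iw : i \in occ A w by rewrite inE.
  by rewrite iw andbT inE; apply/finset.set0Pn; exists i.
split=> //; rewrite atoms_points prE.
under [RHS]eq_bigr do rewrite fsum_setT//.
(* With the point outermost, the inner sum runs over the [i] with [w \in A i]: its numerators add up
   to the denominator times the mass of [w]. *)
rewrite (exchange_big_dep (fun w => w \in \bigcup_(i in [set: 'I_N]) A i)) /=.
  apply: eq_bigr => w; rewrite inE => -[i _ Aiw].
  rewrite -mulr_suml -mulr_suml mulrAC divff ?mul1r// occE.
  (* The cancelled denominator is nonzero because [w] lies in some [A i], which makes [occ A w]
     nonempty. *)
  apply: c_sums; rewrite inE; apply/finset.set0Pn; exists i.
  by rewrite !inE.
by move=> i w _; rewrite !inE => Aiw; exists i.
Qed.
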